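(* Let $X$ be a visual Gromov hyperbolic space whose boundary at infinity $\partial_\infty X$, taken with a visual metric, has finite capacity dimension, $\operatorname{cdim}(\partial_\infty X)<\infty$. Then there exist metric trees $T_1,\dots,T_n$, with $n=\operatorname{cdim}(\partial_\infty X)+1$, and a quasi-isometric embedding $f:X\to T_1\times\dots\times T_n$.
   Context: A map $f:X\to Y$ between metric spaces is a quasi-isometric embedding if there are $\Lambda\ge1$, $\sigma\ge0$ with $\frac1\Lambda|xx'|-\sigma\le|f(x)f(x')|\le\Lambda|xx'|+\sigma$ for all $x,x'\in X$. A metric tree is a geodesic metric space which is a real tree. Products of metric spaces carry the $\ell^2$ product metric. Gromov product: $(x|x')_o=\frac12(|xo|+|x'o|-|xx'|)$. A metric space $X$ is (Gromov) hyperbolic if for some $\delta\ge0$ and base point $o$, $(x|x'')_o\ge\min\{(x|x')_o,(x'|x'')_o\}-\delta$ for all $x,x',x''$. A sequence $(x_i)$ converges to infinity if $(x_i|x_j)_o\to\infty$ as $i,j\to\infty$; two such sequences are equivalent if $(x_i|x_i')_o\to\infty$; $\partial_\infty X$ is the set of equivalence classes. For $\xi,\xi'\in\partial_\infty X$, $(\xi|\xi')_o=\inf\liminf_i(x_i|x_i')_o$ over representatives; for $x\in X$, $(x|\xi)_o=\inf\liminf_i(x|x_i)_o$ over representatives $(x_i)\in\xi$. A metric $d$ on $\partial_\infty X$ is visual if there are $o\in X$, $a>1$, $c_1,c_2>0$ with $c_1a^{-(\xi|\xi')_o}\le d(\xi,\xi')\le c_2a^{-(\xi|\xi')_o}$ for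 all $\xi,\xi'$. $X$ is visual if for some $x_0\in X$ there is $D>0$ such that for every $x\in X$ there is $\xi\in\partial_\infty X$ with $|xx_0|\le(x|\xi)_{x_0}+D$. Capacity dimension: For a family $\mathcal U$ of subsets of a metric space $Z$, $\operatorname{mesh}(\mathcal U)=\sup_{U\in\mathcal U}\operatorname{diam}U$. A family is disjoint if its members are pairwise disjoint; a covering $\mathcal U$ of $Z$ is $(m+1)$-colored if $\mathcal U=\bigcup_{a\in A}\mathcal U^a$ with $|A|=m+1$ and each $\mathcal U^a$ disjoint. For an open covering $\mathcal U$ and $z\in Z$, $L(\mathcal U,z)=\min\{\sup_{U\in\mathcal U}\operatorname{dist}(z,Z\setminus U),\operatorname{mesh}(\mathcal U)\}$ (with $\operatorname{dist}(z,\emptyset)=\infty$) and the Lebesgue number is $L(\mathcal U)=\inf_{z\in Z}L(\mathcal U,z)$. $\operatorname{cdim}(Z)$ is the least integer $m\ge0$ for which there is $\delta>0$ such that for every sufficiently small $\tau>0$ there is an open $(m+1)$-colored covering $\mathcal U$ of $Z$ with $\operatorname{mesh}(\mathcal U)\le\tau$ and $L(\mathcal U)\ge\delta\tau$ (it is $\infty$ if no such $m$ exists). *)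

(* Defs.v *)
From Stdlib Require Import Reals.
From Coquelicot Require Import Coquelicot.
Open Scope R_scope.

Definition is_metric {X : Type} (d : X -> X -> R) : Prop :=
  (forall x y, 0 <= d x y) /\
  (forall x y, d x y = 0 <-> x = y) /\
  (forall x y, d x y = d y x) /\
  (forall x y z, d x z <= d x y + d y z).

Definition qi_embedding {X Y : Type} (dX : X -> X -> R) (dY : Y -> Y -> R)
  (f : X -> Y) : Prop :=
  exists Lam sig, 1 <= Lam /\ 0 <= sig /\
    forall x x', / Lam * dX x x' - sig <= dY (f x) (f x') /\
                 dY (f x) (f x') <= Lam * dX x x' + sig.

Definition geodesic {T : Type} (d : T -> T -> R) (x y : T) (gamma : R -> T) : Prop :=
  gamma 0 = x /\ gamma (d x y) = y /\
  forall s t, 0 <= s <= d x y -> 0 <= t <= d x y ->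
    d (gamma s) (gamma t) = Rabs (s - t).

Definition seg_image {T : Type} (d : T -> T -> R) (x y : T) (gamma : R -> T) (p : T) : Prop :=
  exists t, 0 <= t <= d x y /\ gamma t = p.

Definition metric_tree {T : Type} (d : T -> T -> R) : Prop :=
  is_metric d /\
  (forall x y : T, exists gamma, geodesic d x y gamma) /\
  (forall x y g1 g2, geodesic d x y g1 -> geodesic d x y g2 ->
      forall t, 0 <= t <= d x y -> g1 t = g2 t) /\
  (forall x y z g1 g2 g3,
      geodesic d x y g1 -> geodesic d y z g2 -> geodesic d x z g3 ->
      (forall p, seg_image d x y g1 p -> seg_image d y z g2 p -> p = y) ->
      forall p, seg_image d x z g3 p <-> (seg_image d x y g1 p \/ seg_image d y z g2 p)).

Definition Idx (n : nat) : Type := {i : nat | (i < n)%nat}.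

Definition prod_space (n : nat) (T : Idx n -> Type) : Type := forall i : Idx n, T i.

Definition prod_dist (n : nat) (T : Idx n -> Type) (dT : forall i, T i -> T i -> R)
  (x y : prod_space n T) : R :=
  sqrt (sum_f_R0 (fun j => match Compare_dec.lt_dec j n with
                           | left h => (dT (exist _ j h) (x (exist _ j h)) (y (exist _ j h))) ^ 2
                           | right _ => 0
                           end) (pred n)).

Definition gp {X : Type} (d : X -> X -> R) (o x y : X) : R :=
  / 2 * (d x o + d y o - d x y).

Definition gromov_hyperbolic {X : Type} (d : X -> X -> R) : Prop :=
  exists delta (o : X), 0 <= delta /\
    forall x x' x'', gp d o x x'' >= Rmin (gp d o x x') (gp d o x' x'') - delta.

Definition conv_inf {X : Type} (d : X -> X -> R) (o : X) (s : nat -> X) : Prop :=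
  forall M, exists N, forall i j, (N <= i)%nat -> (N <= j)%nat -> gp d o (s i) (s j) >= M.

Definition equiv_seq {X : Type} (d : X -> X -> R) (o : X) (s t : nat -> X) : Prop :=
  forall M, exists N, forall i, (N <= i)%nat -> gp d o (s i) (t i) >= M.

Definition is_bpoint {X : Type} (d : X -> X -> R) (o : X) (S : (nat -> X) -> Prop) : Prop :=
  exists s0, conv_inf d o s0 /\
    forall t, S t <-> (conv_inf d o t /\ equiv_seq d o t s0).

Definition Boundary {X : Type} (d : X -> X -> R) (o : X) : Type :=
  {S : (nat -> X) -> Prop | is_bpoint d o S}.

Definition gp_bd {X : Type} (d : X -> X -> R) (o p : X) (xi xi' : Boundary d o) : Rbar :=
  Rbar_glb (fun g => exists s t, proj1_sig xi s /\ proj1_sig xi' t /\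
                      g = LimInf_seq (fun i => gp d p (s i) (t i))).

Definition gp_pt_bd {X : Type} (d : X -> X -> R) (o p x : X) (xi : Boundary d o) : Rbar :=
  Rbar_glb (fun g => exists s, proj1_sig xi s /\
                      g = LimInf_seq (fun i => gp d p x (s i))).

Definition apow_neg (a : R) (g : Rbar) : Rbar :=
  match g with
  | Finite r => Finite (Rpower a (- r))
  | p_infty => Finite 0
  | m_infty => p_infty
  end.

Definition visual_metric {X : Type} (d : X -> X -> R) (o : X)
  (dZ : Boundary d o -> Boundary d o -> R) : Prop :=
  is_metric dZ /\
  exists (p : X) (a c1 c2 : R), 1 < a /\ 0 < c1 /\ 0 < c2 /\
    forall xi xi',
      Rbar_le (Rbar_mult (Finite c1) (apow_neg a (gp_bd d o p xi xi'))) (Finite (dZ xi xi')) /\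
      Rbar_le (Finite (dZ xi xi')) (Rbar_mult (Finite c2) (apow_neg a (gp_bd d o p xi xi'))).

Definition visual_space {X : Type} (d : X -> X -> R) : Prop :=
  exists (x0 : X) (D : R), 0 < D /\
    forall x, exists xi : Boundary d x0,
      Rbar_le (Finite (d x x0)) (Rbar_plus (gp_pt_bd d x0 x0 x xi) (Finite D)).

Section Cdim.
Context {Z : Type} (dZ : Z -> Z -> R).

Definition open_set (A : Z -> Prop) : Prop :=
  forall z, A z -> exists r, 0 < r /\ forall w, dZ z w < r -> A w.

Definition diam (A : Z -> Prop) : Rbar :=
  Rbar_lub (fun r => exists x y, A x /\ A y /\ r = Finite (dZ x y)).

Definition mesh (F : (Z -> Prop) -> Prop) : Rbar :=
  Rbar_lub (fun r => exists A, F A /\ r = diam A).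

(* dist(z, A), = +oo for A empty *)
Definition dist_set (z : Z) (A : Z -> Prop) : Rbar :=
  Rbar_glb (fun r => exists a, A a /\ r = Finite (dZ z a)).

Definition leb_at (F : (Z -> Prop) -> Prop) (z : Z) : Rbar :=
  Rbar_min (Rbar_lub (fun r => exists A, F A /\ r = dist_set z (fun w => ~ A w))) (mesh F).

Definition lebesgue (F : (Z -> Prop) -> Prop) : Rbar :=
  Rbar_glb (fun r => exists z, r = leb_at F z).

Definition colored_family (m : nat) (U : nat -> (Z -> Prop) -> Prop) : (Z -> Prop) -> Prop :=
  fun A => exists a, (a <= m)%nat /\ U a A.

Definition open_colored_cover (m : nat) (U : nat -> (Z -> Prop) -> Prop) : Prop :=
  (forall z, exists A, colored_family m U A /\ A z) /\
  (forall A, colored_family m U A -> open_set A) /\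
  (forall a, (a <= m)%nat -> forall A B, U a A -> U a B -> A <> B ->
      forall z, ~ (A z /\ B z)).

Definition cdim_le (m : nat) : Prop :=
  exists delta, 0 < delta /\
    exists tau0, 0 < tau0 /\
      forall tau, 0 < tau -> tau <= tau0 ->
        exists U, open_colored_cover m U /\
          Rbar_le (mesh (colored_family m U)) (Finite tau) /\
          Rbar_le (Finite (delta * tau)) (lebesgue (colored_family m U)).

Definition is_cdim (m : nat) : Prop :=
  cdim_le m /\ forall k, (k < m)%nat -> ~ cdim_le k.
End Cdim.

(* Main.v *)
Require Import Defs.
From Stdlib Require Import Reals Lra Lia Classical ClassicalEpsilon.
From Stdlib Require Import FunctionalExtensionality ProofIrrelevance.
From Coquelicot Require Import Coquelicot.
Open Scope R_scope.

(* By visuality a point [x] is coarsely a pair: a boundary point [zeta x] and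
   its distance to the base point [p], and the Gromov product [(x|x')] is, up to
   a constant, the minimum of the two heights and of [(zeta x|zeta x')].

   Choose colored coverings of the boundary at all scales [tau0 * r ^ j] with
   small [r].  In each color, every member is replaced by a hull absorbing the
   smaller members that it meets, so that hulls of one color are nested or
   disjoint, with a margin proportional to the smaller scale.  The hulls of one
   color containing [zeta x], up to the level of [x], form a chain, and these
   chains are the branches of a tree.

   The distance of [x] and [x'] in that tree is the number of hulls containing
   only one of them.  By the margin, at most one such hull contains [zeta x] at
   the levels of scale larger than a multiple of the distance from [zeta x] to
   [zeta x'], which gives the upper bound.  Conversely each smaller scale
   contributes a separating hull in at least one color. *)

Ltac split_min :=
  unfold Rmin in *;
  repeat match goal with
         | H : context [Rle_dec ?a ?b] |- _ => destruct (Rle_dec a b)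
         | |- context [Rle_dec ?a ?b] => destruct (Rle_dec a b)
         end.

(** * Trees from ultrametric products *)

Definition hyperbolic_at {X : Type} (d : X -> X -> R) (delta : R) (o : X) : Prop :=
  forall x y z, Rmin (gp d o x y) (gp d o y z) - delta <= gp d o x z.

(** In products based at [o], the inequality at [w] reads min((x|y)+(z|w), (y|z)+(x|w)) - 2 delta <=
    (x|z)+(y|w), so [w] is just a fourth point. One instance at [o] bounds each product on the
    right, which costs [delta] twice. *)
Lemma hyperbolic_at_change_base {X : Type} (d : X -> X -> R) (delta : R) (o w : X) :
  (forall x y, d x y = d y x) ->
  hyperbolic_at d delta o -> hyperbolic_at d (2 * delta) w.
Proof.
  intros sym H x y z.
  pose proof (H x y z) as H1. pose proof (H y x w) as H2.
  pose proof (H x w z) as H3. pose proof (H y z w) as H4.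
  unfold gp in *.
  rewrite (sym y x), (sym w z) in *.
  split_min; lra.
Qed.

Lemma geodesic_dist_start {T : Type} (d : T -> T -> R) x y g t :
  geodesic d x y g -> 0 <= t <= d x y -> d x (g t) = t.
Proof.
  intros (g0 & _ & giso) Ht. rewrite <- g0 at 1.
  rewrite giso by lra. rewrite Rabs_left1; lra.
Qed.

Lemma geodesic_dist_end {T : Type} (d : T -> T -> R) x y g t :
  geodesic d x y g -> 0 <= t <= d x y -> d y (g t) = d x y - t.
Proof.
  intros (_ & g1 & giso) Ht. rewrite <- g1 at 1.
  rewrite giso by lra. rewrite Rabs_right; lra.
Qed.

(** Geodesics issuing from [o] towards [x] and [z] coincide up to length (x|z)_o. For [x = z] this
    is uniqueness; for two segments meeting only at their common end it forces the product there to
    vanish, so that their concatenation is geodesic. *)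
Lemma metric_tree_of_zero_hyperbolic {T : Type} (d : T -> T -> R) :
  is_metric d ->
  (forall x y : T, exists gamma, geodesic d x y gamma) ->
  (forall o, hyperbolic_at d 0 o) ->
  metric_tree d.
Proof.
  intros Hd Hg Hh. pose proof Hd as Hm. destruct Hm as (pos & eq0 & sym & tri).
  (* Two points at equal distance from [o], one towards [x], the other towards
     [z], agree as long as this distance is at most [(x|z)_o]. *)
  assert (merge : forall o x z p q t, d o p = t -> d o q = t -> t <= gp d o x z ->
            d x p = d o x - t -> d z q = d o z - t -> p = q).
  { intros o x z p q t Hp Hq Ht Hxp Hzq. apply eq0.
    apply Rle_antisym; [|apply pos].
    pose proof (Hh o p x q) as H1. pose proof (Hh o x z q) as H2. unfold gp in *.
    rewrite (sym p x), (sym p o), (sym x o), (sym q o), (sym z o) in *.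
    split_min; lra. }
  assert (self : forall o x, gp d o x x = d o x).
  { intros o x. unfold gp. rewrite (proj2 (eq0 x x) eq_refl), (sym x o). lra. }
  assert (uniq : forall x y g1 g2, geodesic d x y g1 -> geodesic d x y g2 ->
             forall t, 0 <= t <= d x y -> g1 t = g2 t).
  { intros x y g1 g2 G1 G2 t Ht.
    apply (merge x y y (g1 t) (g2 t) t).
    - eapply geodesic_dist_start; eauto.
    - eapply geodesic_dist_start; eauto.
    - rewrite self; lra.
    - eapply geodesic_dist_end; eauto.
    - eapply geodesic_dist_end; eauto. }
  split; [exact Hd|]. split; [exact Hg|]. split; [exact uniq|].
  intros x y z g1 g2 g3 G1 G2 G3 Hmeet.
  pose proof (tri x y z) as T1. pose proof (tri x z y) as T2. pose proof (tri y x z) as T3.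
  rewrite (sym z y) in T2. rewrite (sym y x) in T3.
  (* The points at distance (x|z)_y from [y] on the two segments coincide, hence equal [y] by
     [Hmeet], and the product is 0. *)
  assert (Hsum : d x z = d x y + d y z).
  { set (t := gp d y x z).
    assert (Et : t = (d x y + d y z - d x z) / 2)
      by (unfold t, gp; rewrite (sym z y); lra).
    assert (b1 : 0 <= d x y - t <= d x y) by lra.
    assert (b2 : 0 <= t <= d y z) by lra.
    assert (P : g1 (d x y - t) = g2 t).
    { apply (merge y x z _ _ t).
      - rewrite (geodesic_dist_end d x y g1) by auto. lra.
      - apply (geodesic_dist_start d y z g2); auto.
      - apply Rle_refl.
      - rewrite (geodesic_dist_start d x y g1) by auto. rewrite (sym y x). lra.
      - apply (geodesic_dist_end d y z g2); auto. }
    assert (Y : g2 t = y).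
    { apply Hmeet; [exists (d x y - t)|exists t]; auto. }
    pose proof (geodesic_dist_start d y z g2 t G2 b2) as E0. rewrite Y in E0.
    rewrite (proj2 (eq0 y y) eq_refl) in E0. lra. }
  pose (g := fun t => if Rle_dec t (d x y) then g1 t else g2 (t - d x y)).
  assert (P1 := pos x y). assert (P2 := pos y z).
  assert (G : geodesic d x z g).
  { pose proof G1 as (g10 & g11 & g1i). pose proof G2 as (g20 & g21 & g2i).
    split; [|split].
    - unfold g. destruct (Rle_dec 0 (d x y)); [auto|lra].
    - unfold g. rewrite Hsum. destruct (Rle_dec (d x y + d y z) (d x y)).
      + assert (E : d y z = 0) by lra. rewrite E, Rplus_0_r, g11. apply eq0; auto.
      + replace (d x y + d y z - d x y) with (d y z) by lra. auto.
    - rewrite Hsum.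
      assert (mixed : forall s t, 0 <= s <= d x y -> 0 <= t <= d y z ->
                d (g1 s) (g2 t) = d x y - s + t).
      { intros s t Hs Ht.
        pose proof (geodesic_dist_start _ _ _ _ _ G1 Hs).
        pose proof (geodesic_dist_end _ _ _ _ _ G1 Hs).
        pose proof (geodesic_dist_start _ _ _ _ _ G2 Ht).
        pose proof (geodesic_dist_end _ _ _ _ _ G2 Ht).
        pose proof (tri (g1 s) y (g2 t)). pose proof (tri x (g1 s) z).
        pose proof (tri (g1 s) (g2 t) z).
        rewrite (sym (g1 s) y), (sym (g2 t) z) in *. lra. }
      intros s t Hs Ht. unfold g.
      destruct (Rle_dec s (d x y)); destruct (Rle_dec t (d x y)).
      + apply g1i; lra.
      + rewrite mixed by lra. rewrite Rabs_left1; lra.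
      + rewrite sym, mixed by lra. rewrite Rabs_right; lra.
      + rewrite g2i by lra. f_equal; lra. }
  assert (E3 : forall t, 0 <= t <= d x z -> g3 t = g t) by (apply uniq; auto).
  intros p; split.
  - intros (t & Ht & <-). rewrite E3 by auto. unfold g.
    destruct (Rle_dec t (d x y)).
    + left; exists t; split; auto; lra.
    + right; exists (t - d x y); split; auto; lra.
  - intros [(t & Ht & <-)|(t & Ht & <-)].
    + exists t. split; [lra|]. rewrite E3 by lra. unfold g.
      destruct (Rle_dec t (d x y)); [auto|lra].
    + exists (d x y + t). split; [lra|]. rewrite E3 by lra. unfold g.
      destruct (Rle_dec (d x y + t) (d x y)).
      * replace t with 0 by lra. destruct G1 as (_ & e1 & _), G2 as (e2 & _).
        rewrite Rplus_0_r, e1, e2; auto.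
      * f_equal; lra.
Qed.

Section MetricQuotient.
Context {T : Type} (d : T -> T -> R)
  (pos : forall x y, 0 <= d x y)
  (refl : forall x, d x x = 0)
  (sym : forall x y, d x y = d y x)
  (tri : forall x y z, d x z <= d x y + d y z).

(** Choice is applied to the predicate of being at distance 0 from [x]. Points at distance 0 have
    equal predicates, by extensionality, and so the same representative. *)
Definition representative (x : T) : T :=
  proj1_sig (constructive_indefinite_description (fun y => d x y = 0)
               (ex_intro _ x (refl x))).

Lemma representative_dist x : d x (representative x) = 0.
Proof. unfold representative. destruct constructive_indefinite_description; auto. Qed.

Lemma dist_zero_compat x y z : d x y = 0 -> d x z = d y z.
Proof.
  intros H. pose proof (tri x y z). pose proof (tri y x z). rewrite (sym y x) in *. lra.
Qed.

Lemma representative_eq x y : d x y = 0 -> representative x = representative y.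
Proof.
  intros H.
  assert (E : (fun z => d x z = 0) = (fun z => d y z = 0)).
  { apply functional_extensionality; intros z. rewrite (dist_zero_compat x y z H). auto. }
  unfold representative.
  generalize (ex_intro (fun z => d x z = 0) x (refl x)).
  generalize (ex_intro (fun z => d y z = 0) y (refl y)).
  rewrite E. intros e1 e2. rewrite (proof_irrelevance _ e1 e2). auto.
Qed.

(** The quotient is realized as the subtype of points that represent themselves. The sum types,
    rather than existentials, allow a space to be extracted for each index later. *)
Lemma metric_quotient :
  {Q : Type & {dQ : Q -> Q -> R & {proj : T -> Q |
    is_metric dQ /\ (forall x y, dQ (proj x) (proj y) = d x y) /\
    (forall q, exists x, proj x = q)}}}.
Proof.
  assert (idem : forall x, representative (representative x) = representative x).
  { intros x. symmetry. apply representative_eq, representative_dist. }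
  exists {x : T | representative x = x}.
  exists (fun p q => d (proj1_sig p) (proj1_sig q)).
  exists (fun x => exist (fun y => representative y = y) (representative x) (idem x)).
  split; [|split].
  - split; [|split; [|split]]; intros; auto.
    destruct x as [x Hx], y as [y Hy]; simpl. split.
    + intros H. apply representative_eq in H.
      apply subset_eq_compat. congruence.
    + intros H. inversion H. auto.
  - intros x y; simpl.
    rewrite <- (dist_zero_compat x _ _ (representative_dist x)), sym.
    rewrite <- (dist_zero_compat y _ _ (representative_dist y)), sym. auto.
  - intros [x Hx]. exists x. apply subset_eq_compat; auto.
Qed.
End MetricQuotient.

(* The rooted tree in which the segments from the root to [s] and to [s'], of
   lengths [p s s] and [p s' s'], share an initial piece of length [p s s']. *)
Lemma tree_of_ultrametric_product {S : Type} (p : S -> S -> R) (s0 : S) :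
  (forall s s', 0 <= p s s') ->
  (forall s s', p s s' = p s' s) ->
  (forall s s', p s s' <= p s s) ->
  (forall s s' s'', Rmin (p s s') (p s' s'') <= p s s'') ->
  {T : Type & {dT : T -> T -> R & {F : S -> T |
    metric_tree dT /\
    forall s s', dT (F s) (F s') = p s s + p s' s' - 2 * p s s'}}}.
Proof.
  intros ppos psym pself pultra.
  pose (inP := fun u : S * R => 0 <= snd u <= p (fst u) (fst u)).
  pose (P := sig inP).
  (* A pair [(s, t)] is the point at height [t] on the branch of [s]; two points branch at the
     height min(t, t', p s s'). *)
  pose (d := fun u v : P => snd (proj1_sig u) + snd (proj1_sig v)
         - 2 * Rmin (Rmin (snd (proj1_sig u)) (snd (proj1_sig v)))
                    (p (fst (proj1_sig u)) (fst (proj1_sig v)))).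
  assert (dpos : forall x y, 0 <= d x y).
  { intros [[s t] H] [[s' t'] H']; unfold inP, d in *; simpl in *. split_min; lra. }
  assert (drefl : forall x, d x x = 0).
  { intros [[s t] H]; unfold inP, d in *; simpl in *. split_min; lra. }
  assert (dsym : forall x y, d x y = d y x).
  { intros [[s t] H] [[s' t'] H']; unfold inP, d in *; simpl in *. rewrite (psym s s').
    split_min; lra. }
  assert (dtri : forall x y z, d x z <= d x y + d y z).
  { intros [[s t] H] [[s' t'] H'] [[s'' t''] H'']; unfold inP, d in *; simpl in *.
    pose proof (pultra s s' s''). split_min; lra. }
  destruct (metric_quotient d dpos drefl dsym dtri) as (T & dT & pr & Hm & Hd & Hs).
  assert (top : forall s, inP (s, p s s)).
  { intros s; unfold inP; simpl. pose proof (ppos s s). lra. }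
  exists T, dT, (fun s => pr (exist inP (s, p s s) (top s))). split.
  - apply metric_tree_of_zero_hyperbolic; auto.
    + intros x y.
      destruct (Hs x) as ([[s t] H] & <-). destruct (Hs y) as ([[s' t'] H'] & <-).
      unfold inP in H, H'; simpl in *. set (q := Rmin (Rmin t t') (p s s')).
      set (D := t + t' - 2 * q).
      assert (Hq : q <= t /\ q <= t' /\ q <= p s s' /\ 0 <= q).
      { unfold q. pose proof (ppos s s'). split_min; lra. }
      (* The path descends the branch of [s] to the branching height [q], then climbs the branch of
         [s']; outside [[0, D]] it takes a default value. *)
      assert (B : forall u, exists v : P, 0 <= u <= D ->
                proj1_sig v = (if Rle_dec u (t - q) then (s, t - u)
                               else (s', q + (u - (t - q))))).
      { intros u. destruct (classic (0 <= u <= D)) as [Hu|Hu].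
        - destruct (Rle_dec u (t - q)).
          + assert (V : inP (s, t - u)) by (unfold inP; simpl; lra).
            exists (exist inP _ V). auto.
          + assert (V : inP (s', q + (u - (t - q))))
              by (unfold inP; simpl; unfold D in *; lra).
            exists (exist inP _ V). auto.
        - exists (exist inP (s, t) H). tauto. }
      pose (g := fun u => proj1_sig (constructive_indefinite_description _ (B u))).
      assert (Hgv : forall u, 0 <= u <= D ->
                proj1_sig (g u) = (if Rle_dec u (t - q) then (s, t - u)
                               else (s', q + (u - (t - q))))).
      { intros u. unfold g. destruct constructive_indefinite_description; auto. }
      assert (HD : dT (pr (exist inP (s, t) H)) (pr (exist inP (s', t') H')) = D).
      { rewrite Hd. unfold d; simpl. fold q. unfold D. lra. }
      assert (HD0 : 0 <= D) by (unfold D; lra).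
      destruct Hm as (mpos & meq0 & msym & mtri).
      exists (fun u => pr (g u)). split; [|split].
      * apply meq0. rewrite Hd. unfold d. rewrite Hgv by lra.
        destruct Rle_dec; simpl; [|lra]. split_min; lra.
      * rewrite HD. apply meq0. rewrite Hd. unfold d. rewrite Hgv by lra.
        destruct Rle_dec; simpl; unfold D in *.
        -- replace (t - (t + t' - 2 * q)) with t' by lra.
           split_min; lra.
        -- split_min; lra.
      * rewrite HD. intros u v Hu Hv. rewrite Hd. unfold d. rewrite !Hgv by lra.
        assert (same : forall r a b, 0 <= a <= p r r -> 0 <= b <= p r r ->
                  a + b - 2 * Rmin (Rmin a b) (p r r) = Rabs (a - b)).
        { intros r a b Ha Hb. unfold Rabs. destruct Rcase_abs; split_min; lra. }
        assert (mixed : forall a b, q <= a <= t -> q <= b <= t' ->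
                  Rmin (Rmin a b) (p s s') = q).
        { intros a b Ha Hb. unfold q in *. split_min; lra. }
        clearbody q.
        destruct (Rle_dec u _), (Rle_dec v _); unfold D in *; simpl.
        -- rewrite same by lra. rewrite <- Rabs_Ropp. f_equal; lra.
        -- rewrite mixed by lra. rewrite Rabs_left1; lra.
        -- rewrite (psym s' s), (Rmin_comm (q + _)), mixed by lra. rewrite Rabs_right; lra.
        -- rewrite same by lra. f_equal; lra.
    (* It suffices to treat the root, at height 0: there the Gromov product is the branching height,
       which is ultrametric. *)
    + intros o. replace 0 with (2 * 0) by lra.
      assert (root : inP (s0, 0)).
      { unfold inP; simpl. pose proof (ppos s0 s0). lra. }
      apply (hyperbolic_at_change_base dT 0 (pr (exist inP (s0, 0) root))).
      { apply Hm. }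
      intros x y z. destruct (Hs x) as ([[s t] H] & <-).
      destruct (Hs y) as ([[s' t'] H'] & <-). destruct (Hs z) as ([[s'' t''] H''] & <-).
      assert (G : forall r a r' a' Ha Ha',
                gp dT (pr (exist inP (s0, 0) root)) (pr (exist inP (r, a) Ha))
                   (pr (exist inP (r', a') Ha')) = Rmin (Rmin a a') (p r r')).
      { intros r a r' a' Ha Ha'. unfold gp. rewrite !Hd. unfold inP, d in *; simpl in *.
        pose proof (ppos r s0). pose proof (ppos r' s0).
        rewrite !(Rmin_right _ 0), !(Rmin_left 0) by lra. lra. }
      rewrite !G. pose proof (pultra s s' s''). clear - H0. split_min; lra.
  - intros s s'. rewrite Hd. unfold d; simpl. pose proof (pself s s').
    pose proof (pself s' s). rewrite (psym s' s) in *. split_min; lra.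
Qed.

(** * Trees from nested partial equivalence relations *)

Fixpoint count_below (P : nat -> Prop) (n : nat) : R :=
  match n with
  | O => 0
  | S n => count_below P n + (if excluded_middle_informative (P n) then 1 else 0)
  end.

Ltac split_mem :=
  repeat match goal with
         | |- context [excluded_middle_informative ?P] =>
             destruct (excluded_middle_informative P)
         end.

Lemma count_below_pos P n : 0 <= count_below P n.
Proof. induction n; simpl; split_mem; lra. Qed.

Lemma count_below_empty n : count_below (fun _ => False) n = 0.
Proof. induction n; simpl; auto. split_mem; tauto || lra. Qed.

Lemma count_below_le P Q n :
  (forall j, (j < n)%nat -> P j -> Q j) -> count_below P n <= count_below Q n.
Proof.
  induction n; intros H; simpl; [lra|].
  assert (count_below P n <= count_below Q n) by (apply IHn; auto).
  split_mem; try lra. exfalso; auto.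
Qed.

Lemma count_below_extend P n k :
  (forall j, (n <= j)%nat -> ~ P j) -> count_below P (n + k) = count_below P n.
Proof.
  intros H. induction k; [rewrite Nat.add_0_r; auto|].
  rewrite Nat.add_succ_r; simpl. rewrite IHk. split_mem; [|lra].
  exfalso. apply (H (n + k)%nat); auto; lia.
Qed.

Lemma count_below_bound P n n' :
  (forall j, P j -> (j < n)%nat) -> (forall j, P j -> (j < n')%nat) ->
  count_below P n = count_below P n'.
Proof.
  intros H H'.
  rewrite <- (count_below_extend P n n'), <- (count_below_extend P n' n).
  - f_equal. lia.
  - intros j Hj Pj. apply H' in Pj. lia.
  - intros j Hj Pj. apply H in Pj. lia.
Qed.

Lemma count_below_split P Q n :
  count_below P n =
  count_below (fun j => P j /\ Q j) n + count_below (fun j => P j /\ ~ Q j) n.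
Proof. induction n; simpl; [lra|]. split_mem; try lra; exfalso; tauto. Qed.

Lemma count_below_gt_upper y n : y <= INR n -> count_below (fun j => y < INR j) n <= INR n - y.
Proof.
  induction n; intros H; [simpl in *; lra|].
  destruct (Rle_dec y (INR n)) as [Hy|Hy].
  - rewrite S_INR in *. simpl. specialize (IHn Hy). split_mem; lra.
  - assert (E : count_below (fun j => y < INR j) (S n) <= count_below (fun _ => False) (S n)).
    { apply count_below_le. intros j Hj Hlt. assert (INR j <= INR n) by (apply le_INR; lia). lra. }
    rewrite count_below_empty in E. lra.
Qed.

Lemma count_below_gt_lower y n : 0 <= y -> INR n - y - 1 <= count_below (fun j => y < INR j) n.
Proof.
  intros H. induction n; [simpl in *; lra|].
  pose proof (count_below_pos (fun j => y < INR j) n).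
  rewrite S_INR in *. simpl. split_mem; lra.
Qed.

Lemma count_below_le_one P n :
  (forall i j, (i < j)%nat -> (j < n)%nat -> P i -> P j -> False) -> count_below P n <= 1.
Proof.
  induction n; intros H; simpl; [lra|].
  split_mem.
  - assert (E : count_below P n <= count_below (fun _ => False) n).
    { apply count_below_le. intros i Hi Pi. apply (H i n); auto. }
    rewrite count_below_empty in E. lra.
  - assert (count_below P n <= 1); [|lra]. apply IHn. intros i j Hij Hj. apply H; auto.
Qed.

Lemma count_below_or P Q R n :
  (forall j, (j < n)%nat -> P j -> Q j \/ R j) ->
  count_below P n <= count_below Q n + count_below R n.
Proof.
  induction n; intros H; simpl; [lra|].
  assert (count_below P n <= count_below Q n + count_below R n) by (apply IHn; auto).
  split_mem; try lra. exfalso. destruct (H n); auto.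
Qed.

Lemma count_below_union (Q : nat -> Prop) (P : nat -> nat -> Prop) m n :
  (forall j, (j < n)%nat -> Q j -> exists a, (a <= m)%nat /\ P a j) ->
  count_below Q n <= sum_f_R0 (fun a => count_below (P a) n) m.
Proof.
  revert Q. induction m; intros Q H; simpl.
  - apply count_below_le. intros j Hj HQ. destruct (H j Hj HQ) as (a & Ha & Pa).
    replace 0%nat with a by lia. auto.
  - assert (count_below Q n <= count_below (fun j => exists a, (a <= m)%nat /\ P a j) n
              + count_below (P (S m)) n).
    { apply count_below_or. intros j Hj HQ. destruct (H j Hj HQ) as (a & Ha & Pa).
      destruct (Nat.eq_dec a (S m)) as [->|]; [tauto|]. left; exists a; split; auto; lia. }
    pose proof (IHm (fun j => exists a, (a <= m)%nat /\ P a j)) as I.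
    specialize (I ltac:(auto)). lra.
Qed.

(* The level-[j] classes of the partial equivalence relations [F j] become the
   vertices at which two branches may still agree; nestedness makes the levels
   common to [s] and [s'] an initial part of the levels of [s]. *)
Lemma tree_of_nested_relations {A : Type} (b : A -> nat) (F : nat -> A -> A -> Prop) (s0 : A) :
  (forall j s s', F j s s' -> (j < b s)%nat) ->
  (forall j s s', F j s s' -> F j s' s) ->
  (forall j s s' s'', F j s s' -> F j s' s'' -> F j s s'') ->
  (forall i j s s', (i < j)%nat -> F i s s -> F j s s' -> F i s s') ->
  {T : Type & {dT : T -> T -> R & {f : A -> T |
    metric_tree dT /\
    forall s s', dT (f s) (f s') =
      count_below (fun j => F j s s /\ ~ F j s s') (b s) +
      count_below (fun j => F j s' s' /\ ~ F j s' s) (b s')}}}.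
Proof.
  intros Fb Fsym Ftrans Fnest.
  assert (Frefl : forall j s s', F j s s' -> F j s s) by eauto.
  pose (p := fun s s' => count_below (fun j => F j s s') (b s)).
  assert (pN : forall s s' n, (b s <= n)%nat \/ (b s' <= n)%nat ->
            p s s' = count_below (fun j => F j s s') n).
  { intros s s' n H. apply count_below_bound; [eauto|].
    intros j Hj. destruct H.
    - apply Nat.lt_le_trans with (b s); eauto.
    - apply Nat.lt_le_trans with (b s'); eauto. }
  assert (psym : forall s s', p s s' = p s' s).
  { intros s s'. rewrite (pN s s' (b s')) by auto. unfold p.
    apply Rle_antisym; apply count_below_le; auto. }
  destruct (tree_of_ultrametric_product p s0) as (T & dT & f & HT & Hf).
  - intros. apply count_below_pos.
  - exact psym.
  - intros s s'. apply count_below_le. eauto.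
  - intros s s' s''.
    rewrite (pN s s' (b s')), (pN s' s'' (b s')) by auto.
    (* Otherwise some level [j] relates [s'] to [s] but not to [s'']. By nestedness every level
       relating [s'] to [s''] is then coarser than [j], hence also relates [s'] to [s]. *)
    destruct (classic (forall j, F j s s' -> F j s' s'')) as [H|H].
    + eapply Rle_trans; [apply Rmin_l|].
      rewrite <- (pN s s' (b s')) by auto. apply count_below_le. eauto.
    + apply not_all_ex_not in H. destruct H as (j & H). apply imply_to_and in H.
      destruct H as (H1 & H2). eapply Rle_trans; [apply Rmin_r|].
      rewrite <- (pN s' s'' (b s')) by auto. rewrite (pN s' s'' (b s'')), (pN s s'' (b s'')) by auto.
      apply count_below_le. intros i _ Hi. apply Ftrans with s'; auto.
      destruct (Nat.lt_trichotomy i j) as [L|[L|L]].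
      * apply Fsym. apply Fnest with j; eauto.
      * subst i; contradiction.
      * exfalso. apply H2. apply Fnest with i; eauto.
  - exists T, dT, f. split; auto. intros s s'. rewrite Hf.
    unfold p at 1 2. rewrite (count_below_split (fun j => F j s s) (fun j => F j s s')).
    rewrite (count_below_split (fun j => F j s' s') (fun j => F j s' s)).
    assert (E : forall s s', count_below (fun j => F j s s /\ F j s s') (b s) = p s s').
    { intros u v. apply Rle_antisym; apply count_below_le; [tauto|eauto]. }
    rewrite !E, (psym s' s). lra.
Qed.

(** * Nested hulls of colored coverings *)

Section Hulls.
Context {Z : Type} (dZ : Z -> Z -> R) (metZ : is_metric dZ)
  (tau : nat -> R) (eta eps : R) (U : nat -> (Z -> Prop) -> Prop)
  (tau_pos : forall k, 0 < tau k)
  (tau_shrink : forall k, 8 * tau (S k) <= eps * tau k)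
  (eps_pos : 0 < eps) (eps_small : eps <= / 4) (eps_eta : 2 * eps <= eta)
  (U_disjoint : forall k A B z, U k A -> U k B -> A z -> B z -> A = B)
  (U_diam : forall k A z w, U k A -> A z -> A w -> dZ z w <= tau k).

Definition core (k : nat) (A : Z -> Prop) (z : Z) : Prop :=
  forall w, dZ z w < eta * tau k -> A w.

Definition fat_core (k : nat) (A : Z -> Prop) (z : Z) : Prop :=
  exists u, core k A u /\ dZ u z < eps * tau k.

(** Each step stays in one fattened core. The bound [K] on the levels makes induction on the number
    of available levels possible; [hull] quantifies over it. *)
Inductive chain (j K : nat) : Z -> Z -> Prop :=
| chain_refl z : chain j K z z
| chain_snoc z w v k A : chain j K z w -> (j < k <= K)%nat -> U k A ->
    fat_core k A w -> fat_core k A v -> chain j K z v.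

(* The smallest set containing the core of [A] and every fattened core of a
   deeper level that it meets.  The core of [A] itself is not fattened: this
   leaves a margin around the hull inside the fattened core of [A]. *)
Definition hull (j : nat) (A : Z -> Prop) (z : Z) : Prop :=
  exists v K, core j A v /\ chain j K v z.

Lemma fat_core_sub k A z : fat_core k A z -> A z.
Proof. intros (u & Hu & H). apply Hu. pose proof (tau_pos k). nra. Qed.

(** As [2 * eps <= eta], a fattened core keeps a distance [eps * tau k] to the complement of its
    member, more than [2 * tau (S k)]. Thus [w] lies in both members, which disjointness
    identifies. *)
Lemma fat_core_separated k A B z w : U k A -> U k B ->
  fat_core k A z -> fat_core k B w -> dZ z w <= 2 * tau (S k) -> A = B.
Proof.
  intros HA HB (u & Hu & Huz) Hw Hzw. destruct metZ as (pos & eq0 & sym & tri).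
  apply (U_disjoint k A B w); auto.
  - apply Hu. pose proof (tri u z w). pose proof (tau_shrink k). pose proof (tau_pos k). nra.
  - eapply fat_core_sub; eauto.
Qed.

Lemma chain_weaken j j' K K' z w : (j' <= j)%nat -> (K <= K')%nat ->
  chain j K z w -> chain j' K' z w.
Proof.
  intros Hj HK H. induction H; [constructor|].
  apply chain_snoc with w k A; auto. lia.
Qed.

(* Peeling off the coarsest level of a chain: since deeper chains are too short
   to link two members of that level, at most one member of it is used. *)
Lemma chain_diam j n z w : chain j (j + n) z w -> dZ z w <= 2 * tau (S j).
Proof.
  destruct metZ as (pos & eq0 & sym & tri).
  revert j z w. induction n; intros j z w H.
  - destruct H as [|z w v k A _ Hk]; [|lia].
    rewrite (proj2 (eq0 z z) eq_refl). pose proof (tau_pos (S j)). lra.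
  - assert (IH : forall z w, chain (S j) (j + S n) z w -> dZ z w <= 2 * tau (S (S j))).
    { intros a b Hab. apply IHn. replace (S j + n)%nat with (j + S n)%nat by lia. auto. }
    clear IHn.
    (* If level [S j] occurs, the chain splits as deep, one member of level [S j], deep: a deep
       piece has length at most [2 * tau (S (S j))], too short to reach a second member. The total
       is at most [tau (S j) + 4 * tau (S (S j))]. *)
    assert (D : chain (S j) (j + S n) z w \/
      exists A z' w', U (S j) A /\ fat_core (S j) A z' /\ fat_core (S j) A w' /\
        chain (S j) (j + S n) z z' /\ chain (S j) (j + S n) w' w).
    { induction H as [z|z w v k A H IHc Hk HA Hw Hv]; [left; constructor|].
      destruct (Nat.eq_dec k (S j)) as [->|Nk].
      - right. destruct IHc as [IHc|(B & z' & w' & HB & Hz' & Hw' & C1 & C2)].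
        + exists A, w, v. repeat split; auto. constructor.
        + assert (B = A).
          { eapply (fat_core_separated (S j)); eauto. }
          subst B. exists A, z', v. repeat split; auto. constructor.
      - assert (Hk' : (S j < k <= j + S n)%nat) by lia.
        destruct IHc as [IHc|(B & z' & w' & HB & Hz' & Hw' & C1 & C2)].
        + left. apply chain_snoc with w k A; auto.
        + right. exists B, z', w'. repeat split; auto. apply chain_snoc with w k A; auto. }
    pose proof (tau_shrink (S j)). pose proof (tau_pos (S j)).
    destruct D as [D|(A & z' & w' & HA & Hz' & Hw' & C1 & C2)].
    + apply IH in D. nra.
    + apply IH in C1. apply IH in C2.
      pose proof (U_diam (S j) A z' w' HA (fat_core_sub _ _ _ Hz') (fat_core_sub _ _ _ Hw')).
      pose proof (tri z z' w). pose proof (tri z' w' w). nra.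
Qed.

Lemma hull_near_core j A z : hull j A z ->
  exists v, core j A v /\ dZ v z <= eps / 4 * tau j.
Proof.
  intros (v & K & Hv & H). exists v; split; auto.
  apply (chain_weaken j j K (j + K)) in H; [|lia|lia].
  apply chain_diam in H. pose proof (tau_shrink j). lra.
Qed.

(** Chains leave the core by at most [eps / 4 * tau j], so a further [eps / 2 * tau j] still fits in
    the fattening by [eps * tau j]. *)
Lemma hull_fat_core j A z w : hull j A z -> dZ z w < eps / 2 * tau j -> fat_core j A w.
Proof.
  intros Hz Hzw. destruct (hull_near_core j A z Hz) as (v & Hv & H).
  destruct metZ as (pos & eq0 & sym & tri).
  exists v; split; auto. pose proof (tri v z w). pose proof (tau_pos j). nra.
Qed.

Lemma hull_fat_core_self j A z : hull j A z -> fat_core j A z.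
Proof.
  intros H. apply (hull_fat_core j A z); auto. destruct metZ as (pos & eq0 & sym & tri).
  rewrite (proj2 (eq0 z z) eq_refl). pose proof (tau_pos j). nra.
Qed.

Lemma core_hull j A z : core j A z -> hull j A z.
Proof. intros H. exists z, 0%nat. split; auto. constructor. Qed.

Lemma hull_closed i j A B z w : (i < j)%nat -> U j B ->
  hull i A z -> fat_core j B z -> fat_core j B w -> hull i A w.
Proof.
  intros Hij HB (v & K & Hv & H) Hz Hw. exists v, (max K j). split; auto.
  apply chain_snoc with z j B; auto; [|lia].
  eapply chain_weaken; [| |exact H]; lia.
Qed.

(** A partial equivalence relation: reflexivity at [z] means that [z] lies in some hull of level
    [j]. *)
Definition same_hull (j : nat) (z w : Z) : Prop :=
  exists A, U j A /\ hull j A z /\ hull j A w.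

Lemma same_hull_sym j z w : same_hull j z w -> same_hull j w z.
Proof. intros (A & H). exists A. tauto. Qed.

Lemma same_hull_trans j z w v : same_hull j z w -> same_hull j w v -> same_hull j z v.
Proof.
  intros (A & HA & Hz & Hw) (B & HB & Hw' & Hv).
  assert (A = B).
  { apply (U_disjoint j A B w); auto; eapply fat_core_sub, hull_fat_core_self; eauto. }
  subst B. exists A; auto.
Qed.

Lemma same_hull_diam j z w : same_hull j z w -> dZ z w <= tau j.
Proof.
  intros (A & HA & Hz & Hw). apply (U_diam j A); auto;
    eapply fat_core_sub, hull_fat_core_self; eauto.
Qed.

Lemma same_hull_nested i j z w : (i < j)%nat ->
  same_hull i z z -> same_hull j z w -> same_hull i z w.
Proof.
  intros Hij (A & HA & Hz & _) (B & HB & Hz' & Hw). exists A. repeat split; auto.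
  apply (hull_closed i j A B z); auto; apply hull_fat_core_self; auto.
Qed.

(** The point [w] may miss the finer hull, but it lies in the fattened core around it; the coarser
    hull meets this fattened core at [z] and so absorbs all of it. *)
Lemma same_hull_margin i j z w : (i < j)%nat ->
  same_hull i z z -> same_hull j z z -> dZ z w < eps / 2 * tau j -> same_hull i z w.
Proof.
  intros Hij (A & HA & Hz & _) (B & HB & Hz' & _) H. exists A. repeat split; auto.
  apply (hull_closed i j A B z); auto.
  - apply hull_fat_core_self; auto.
  - apply hull_fat_core with z; auto.
Qed.
End Hulls.

(** * From capacity dimension to nested relations *)

Lemma Rbar_lub_correct (E : Rbar -> Prop) : Rbar_is_lub E (Rbar_lub E).
Proof. exact (proj2_sig (Rbar_ex_lub E)). Qed.

Lemma Rbar_glb_correct (E : Rbar -> Prop) : Rbar_is_glb E (Rbar_glb E).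
Proof. exact (proj2_sig (Rbar_ex_glb E)). Qed.

(** The supremum in the Lebesgue number need not be attained, hence the strict [s < l]. *)
Lemma lebesgue_ball {Z : Type} (dZ : Z -> Z -> R) (F : (Z -> Prop) -> Prop) (l s : R) (z : Z) :
  Rbar_le (Finite l) (lebesgue dZ F) -> s < l ->
  exists A, F A /\ forall w, dZ z w < s -> A w.
Proof.
  intros H Hs. apply NNPP. intros N.
  assert (B : Rbar_le (leb_at dZ F z) (Finite s)).
  { unfold leb_at. eapply Rbar_le_trans; [apply Rbar_min_l|].
    apply (proj2 (Rbar_lub_correct _)). intros r (A & HA & ->).
    apply Rbar_not_lt_le. intros Lt. apply N. exists A; split; auto.
    intros w Hw. apply NNPP. intros nA.
    assert (L : Rbar_le (dist_set dZ z (fun w => ~ A w)) (Finite (dZ z w))).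
    { apply (proj1 (Rbar_glb_correct _)). exists w; auto. }
    pose proof (Rbar_lt_le_trans _ _ _ Lt L) as C. simpl in C. lra. }
  assert (L : Rbar_le (lebesgue dZ F) (leb_at dZ F z)).
  { apply (proj1 (Rbar_glb_correct _)). exists z; auto. }
  pose proof (Rbar_le_trans _ _ _ H (Rbar_le_trans _ _ _ L B)) as C. simpl in C. lra.
Qed.

Lemma mesh_dist {Z : Type} (dZ : Z -> Z -> R) (F : (Z -> Prop) -> Prop) (t : R) A z w :
  Rbar_le (mesh dZ F) (Finite t) -> F A -> A z -> A w -> dZ z w <= t.
Proof.
  intros H HA Hz Hw.
  assert (L1 : Rbar_le (diam dZ A) (mesh dZ F)).
  { apply (proj1 (Rbar_lub_correct _)). exists A; auto. }
  assert (L2 : Rbar_le (Finite (dZ z w)) (diam dZ A)).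
  { apply (proj1 (Rbar_lub_correct _)). exists z, w; auto. }
  exact (Rbar_le_trans _ _ _ L2 (Rbar_le_trans _ _ _ L1 H)).
Qed.

(** All that the embedding takes from the capacity dimension. The ratio [r] stays free below [r0],
    to be matched later with the visual metric. *)
Lemma cdim_le_nested_relations {Z : Type} (dZ : Z -> Z -> R) (m : nat) :
  is_metric dZ -> cdim_le dZ m ->
  exists tau0 r0 c, 0 < tau0 /\ 0 < r0 /\ 0 < c /\
  forall r, 0 < r -> r <= r0 ->
  exists E : nat -> nat -> Z -> Z -> Prop,
    (forall a j z w, E a j z w -> E a j w z) /\
    (forall a j z w v, E a j z w -> E a j w v -> E a j z v) /\
    (forall a j z w, E a j z w -> dZ z w <= tau0 * r ^ j) /\
    (forall a i j z w, (i < j)%nat -> E a i z z -> E a j z w -> E a i z w) /\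
    (forall a i j z w, (i < j)%nat -> E a i z z -> E a j z z ->
       dZ z w < c * (tau0 * r ^ j) -> E a i z w) /\
    (forall j z, exists a, (a <= m)%nat /\ E a j z z).
Proof.
  intros Hm (delta & Hdelta & tau0 & Htau0 & Hcov).
  (* Halving [delta] gives the strict inequality of [lebesgue_ball], so the cores still cover; [eps]
     is the largest value that the hull construction allows. *)
  pose (eta := delta / 2). pose (eps := Rmin (/ 4) (eta / 2)).
  assert (He : 0 < eta) by (unfold eta; lra).
  assert (Heps : 0 < eps /\ eps <= / 4 /\ 2 * eps <= eta).
  { unfold eps. split_min; lra. }
  destruct Heps as (Heps & Heps4 & Hepseta).
  exists tau0, (eps / 8), (eps / 2). split; [auto|]. split; [lra|]. split; [lra|].
  intros r Hr Hr0. pose (tau := fun k => tau0 * r ^ k).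
  assert (tau_pos : forall k, 0 < tau k).
  { intros k. apply Rmult_lt_0_compat; auto. apply pow_lt; auto. }
  assert (tau_S : forall k, tau (S k) = r * tau k).
  { intros k. unfold tau. simpl. ring. }
  assert (tau_le : forall k, tau k <= tau0).
  { induction k; [unfold tau; simpl; lra|]. rewrite tau_S. pose proof (tau_pos k). nra. }
  assert (Hall : forall k, exists U, open_colored_cover dZ m U /\
            Rbar_le (mesh dZ (colored_family m U)) (Finite (tau k)) /\
            Rbar_le (Finite (delta * tau k)) (lebesgue dZ (colored_family m U))).
  { intros k. apply Hcov; auto. }
  pose (V := fun k => proj1_sig (constructive_indefinite_description _ (Hall k))).
  assert (HV : forall k, open_colored_cover dZ m (V k) /\
            Rbar_le (mesh dZ (colored_family m (V k))) (Finite (tau k)) /\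
            Rbar_le (Finite (delta * tau k)) (lebesgue dZ (colored_family m (V k)))).
  { intros k. unfold V. destruct constructive_indefinite_description; auto. }
  clearbody V. clear Hall Hcov.
  (* Colors beyond [m] are emptied, since nothing is known about [V] there. *)
  pose (U := fun a k A => (a <= m)%nat /\ V k a A).
  assert (Udis : forall a k A B z, U a k A -> U a k B -> A z -> B z -> A = B).
  { intros a k A B z (Ha & HA) (_ & HB) Az Bz. apply NNPP. intros N.
    destruct (HV k) as ((_ & _ & D) & _). exact (D a Ha A B HA HB N z (conj Az Bz)). }
  assert (Udiam : forall a k A z w, U a k A -> A z -> A w -> dZ z w <= tau k).
  { intros a k A z w (Ha & HA). apply (mesh_dist dZ (colored_family m (V k))).
    - apply HV.
    - exists a; auto. }
  assert (tau_shrink : forall k, 8 * tau (S k) <= eps * tau k).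
  { intros k. rewrite tau_S. pose proof (tau_pos k). nra. }
  exists (fun a => same_hull dZ tau eta eps (U a)).
  split; [|split; [|split; [|split; [|split]]]].
  - intros a. apply same_hull_sym.
  - intros a. apply same_hull_trans; auto. apply Udis. apply Udiam.
  - intros a. apply same_hull_diam; auto. apply Udis. apply Udiam.
  - intros a. apply same_hull_nested; auto. apply Udis. apply Udiam.
  - intros a. apply same_hull_margin; auto. apply Udis. apply Udiam.
  - intros j z. destruct (HV j) as (_ & _ & L).
    destruct (lebesgue_ball dZ _ _ (eta * tau j) z L) as (A & (a & Ha & HA) & Hball).
    + unfold eta. pose proof (tau_pos j). nra.
    + exists a; split; auto. exists A. split; [split; auto|].
      split; apply core_hull; exact Hball.
Qed.

(** * Gromov products at infinity *)

Lemma LimInf_seq_ge (u : nat -> R) (l : R) N :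
  (forall i, (N <= i)%nat -> l <= u i) -> Rbar_le (Finite l) (LimInf_seq u).
Proof.
  intros H. rewrite <- (LimInf_seq_const l). apply LimInf_le. exists N. exact H.
Qed.

Lemma LimInf_seq_gt_eventually (u : nat -> R) (l s : R) :
  Rbar_le (Finite l) (LimInf_seq u) -> s < l ->
  exists N, forall i, (N <= i)%nat -> s < u i.
Proof.
  unfold LimInf_seq. destruct (ex_LimInf_seq u) as [[L| |] HL]; simpl; intros H Hs.
  - assert (He : 0 < L - s) by lra.
    destruct (HL (mkposreal _ He)) as (_ & N & HN). exists N. intros i Hi.
    specialize (HN i Hi). simpl in HN. lra.
  - apply HL.
  - contradiction.
Qed.

Section Boundary.
Context {X : Type} (d : X -> X -> R) (metX : is_metric d).

Lemma gp_base o p x y : gp d o x y <= gp d p x y + d o p.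
Proof.
  destruct metX as (pos & eq0 & sym & tri). unfold gp.
  pose proof (tri x p o). pose proof (tri y p o). rewrite (sym o p). lra.
Qed.

Lemma gp_le_dist o x y : gp d o x y <= d x o.
Proof.
  destruct metX as (pos & eq0 & sym & tri). unfold gp.
  pose proof (tri y x o). rewrite (sym x y). lra.
Qed.

Lemma gp_nonneg o x y : 0 <= gp d o x y.
Proof.
  destruct metX as (pos & eq0 & sym & tri). unfold gp.
  pose proof (tri x o y). rewrite (sym o y) in *. lra.
Qed.

Lemma gp_sym o x y : gp d o x y = gp d o y x.
Proof. destruct metX as (pos & eq0 & sym & tri). unfold gp. rewrite (sym x y). lra. Qed.

Lemma conv_inf_base o p s : conv_inf d o s -> conv_inf d p s.
Proof.
  intros H M. destruct (H (M + d o p)) as (N & HN). exists N. intros i j Hi Hj.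
  specialize (HN i j Hi Hj). pose proof (gp_base o p (s i) (s j)). lra.
Qed.

Lemma equiv_seq_base o p s t : equiv_seq d o s t -> equiv_seq d p s t.
Proof.
  intros H M. destruct (H (M + d o p)) as (N & HN). exists N. intros i Hi.
  specialize (HN i Hi). pose proof (gp_base o p (s i) (t i)). lra.
Qed.

(** Visuality brings its own base point; the same set of sequences is transported to the boundary
    formed at [o]. *)
Lemma is_bpoint_base o p S : is_bpoint d o S -> is_bpoint d p S.
Proof.
  intros (s & Hs & H). exists s. split; [eapply conv_inf_base; eauto|].
  intros t. rewrite H. split; intros (H1 & H2); split;
    eauto using conv_inf_base, equiv_seq_base.
Qed.

Lemma Boundary_has_representative o (xi : Boundary d o) : exists s, proj1_sig xi s.
Proof.
  destruct xi as (S & s & Hs & H). exists s. simpl. apply H. split; auto.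
  intros M. destruct (Hs M) as (N & HN). exists N. intros i Hi. apply HN; auto.
Qed.

(** A coarse substitute for [x] lying on a geodesic ray from [p] to [xi]. *)
Definition shadows (p : X) (C : R) {o : X} (xi : Boundary d o) (x : X) : Prop :=
  forall s, proj1_sig xi s ->
    exists N, forall i, (N <= i)%nat -> d x p - C <= gp d p x (s i).

Lemma visual_space_shadows o p : visual_space d ->
  exists C, 0 <= C /\ forall x, exists xi : Boundary d o, shadows p C xi x.
Proof.
  intros (x0 & D & HD & H). destruct metX as (pos & eq0 & sym & tri).
  (* [D] comes from visuality, 1 from passing from the lower limit to actual terms, and the rest
     from moving the base point in both the height and the product. *)
  exists (D + 1 + 2 * d p x0). split; [pose proof (pos p x0); lra|].
  intros x. destruct (H x) as ([S HS] & Hx).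
  exists (exist (is_bpoint d o) S (is_bpoint_base x0 o S HS)).
  intros s Hs. simpl in Hs.
  assert (L : Rbar_le (gp_pt_bd d x0 x0 x (exist _ S HS))
                (LimInf_seq (fun i => gp d x0 x (s i)))).
  { apply (proj1 (Rbar_glb_correct _)). exists s; auto. }
  assert (L' : Rbar_le (Finite (d x x0 - D)) (gp_pt_bd d x0 x0 x (exist _ S HS))).
  { destruct (gp_pt_bd d x0 x0 x (exist _ S HS)); simpl in *; auto; lra. }
  destruct (LimInf_seq_gt_eventually _ _ (d x x0 - D - 1) (Rbar_le_trans _ _ _ L' L))
    as (N & HN); [lra|].
  exists N. intros i Hi. specialize (HN i Hi).
  pose proof (gp_base x0 p x (s i)). pose proof (tri x x0 p).
  rewrite (sym x0 p) in *. lra.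
Qed.

Context (delta : R) (p : X) (delta_nonneg : 0 <= delta) (hyp : hyperbolic_at d delta p).

Lemma gp_chain x y z w :
  Rmin (gp d p x y) (Rmin (gp d p y z) (gp d p z w)) - 2 * delta <= gp d p x w.
Proof.
  pose proof (hyp x y w). pose proof (hyp y z w). split_min; lra.
Qed.

Lemma gp_bd_ge o C (xi xi' : Boundary d o) x x' :
  0 <= C -> shadows p C xi x -> shadows p C xi' x' ->
  Rbar_le (Finite (gp d p x x' - (C + 2 * delta))) (gp_bd d o p xi xi').
Proof.
  intros HC H H'. apply (proj2 (Rbar_glb_correct _)).
  intros r (s & s' & Hs & Hs' & ->).
  destruct (H s Hs) as (N & HN). destruct (H' s' Hs') as (N' & HN').
  apply LimInf_seq_ge with (max N N'). intros i Hi.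
  specialize (HN i ltac:(lia)). specialize (HN' i ltac:(lia)).
  pose proof (gp_le_dist p x x'). pose proof (gp_le_dist p x' x).
  rewrite (gp_sym p x' x) in *. rewrite (gp_sym p x (s i)) in *.
  pose proof (gp_chain (s i) x x' (s' i)). split_min; lra.
Qed.

(** Hyperbolicity along [x], [s i], [s' i], [x']. A real lower bound [M] replaces the boundary
    product, which may be infinite; the extra 1 pays for the lower limit. *)
Lemma gp_ge_min_gp_bd o C (xi xi' : Boundary d o) x x' M :
  0 <= C -> shadows p C xi x -> shadows p C xi' x' ->
  Rbar_le (Finite M) (gp_bd d o p xi xi') ->
  Rmin (Rmin (d x p) (d x' p)) M - (C + 1 + 2 * delta) <= gp d p x x'.
Proof.
  intros HC H H' HM.
  destruct (Boundary_has_representative o xi) as (s & Hs).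
  destruct (Boundary_has_representative o xi') as (s' & Hs').
  destruct (H s Hs) as (N & HN). destruct (H' s' Hs') as (N' & HN').
  assert (L : Rbar_le (gp_bd d o p xi xi') (LimInf_seq (fun i => gp d p (s i) (s' i)))).
  { apply (proj1 (Rbar_glb_correct _)). exists s, s'; auto. }
  destruct (LimInf_seq_gt_eventually _ _ (M - 1) (Rbar_le_trans _ _ _ HM L))
    as (N'' & HN''); [lra|].
  set (i := max N (max N' N'')).
  specialize (HN i ltac:(lia)). specialize (HN' i ltac:(lia)). specialize (HN'' i ltac:(lia)).
  rewrite (gp_sym p x' (s' i)) in *.
  pose proof (gp_chain x (s i) (s' i) x'). split_min; lra.
Qed.
End Boundary.

Lemma exp_monotone x y : x <= y -> exp x <= exp y.
Proof. intros [H| ->]; [left; apply exp_increasing|right]; auto. Qed.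

(** Makes precise that (x|x') is coarsely the minimum of both heights and the boundary product, with
    the latter read off from [dZ]. The threshold [M] covers the case of equal boundary points. *)
Lemma visual_boundary_model {X : Type} (d : X -> X -> R) (o : X)
  (dZ : Boundary d o -> Boundary d o -> R) :
  is_metric d -> gromov_hyperbolic d -> visual_space d -> visual_metric d o dZ ->
  exists (p : X) (zeta : X -> Boundary d o) (alpha C c1 c2 : R),
    0 < alpha /\ 0 <= C /\ 0 < c1 /\ 0 < c2 /\
    forall x x',
      dZ (zeta x) (zeta x') <= c2 * exp (- (alpha * (gp d p x x' - C))) /\
      forall M, dZ (zeta x) (zeta x') < c1 * exp (- (alpha * M)) ->
        Rmin (Rmin (d x p) (d x' p)) M - C <= gp d p x x'.
Proof.
  intros Hm (delta0 & o' & Hd0 & Hhyp0) Hvis (HmZ & p & a & c1 & c2 & Ha & Hc1 & Hc2 & Hv).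
  assert (Hhyp : hyperbolic_at d (2 * delta0) p).
  { apply hyperbolic_at_change_base with o'; [apply Hm|].
    intros x y z. apply Rge_le, Hhyp0. }
  set (delta := 2 * delta0) in *. assert (Hdelta : 0 <= delta) by (unfold delta; lra).
  destruct (visual_space_shadows d Hm o p Hvis) as (C & HC & Hsh).
  pose (zeta := fun x => proj1_sig (constructive_indefinite_description _ (Hsh x))).
  assert (Hz : forall x, shadows d p C (zeta x) x).
  { intros x. unfold zeta. destruct constructive_indefinite_description; auto. }
  clearbody zeta.
  exists p, zeta, (ln a), (C + 1 + 2 * delta), c1, c2.
  assert (Hln : 0 < ln a) by (rewrite <- ln_1; apply ln_increasing; lra).
  split; [auto|]. split; [lra|]. split; [auto|]. split; [auto|].
  intros x x'. destruct (Hv (zeta x) (zeta x')) as (Hlow & Hup).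
  pose proof (gp_bd_ge d Hm delta p Hdelta Hhyp o C _ _ x x' HC (Hz x) (Hz x')) as B1.
  pose proof (gp_ge_min_gp_bd d Hm delta p Hdelta Hhyp o C (zeta x) (zeta x') x x') as B2.
  split.
  - destruct (gp_bd d o p (zeta x) (zeta x')) as [r| |]; simpl in *; [|rewrite Rmult_0_r in Hup|contradiction].
    + eapply Rle_trans; [exact Hup|]. apply Rmult_le_compat_l; [lra|].
      unfold Rpower. apply exp_monotone. nra.
    + eapply Rle_trans; [exact Hup|]. apply Rmult_le_pos; [lra|]. left; apply exp_pos.
  - intros M HM. apply B2; auto.
    destruct (gp_bd d o p (zeta x) (zeta x')) as [r| |]; simpl in *; auto.
    unfold Rpower in Hlow.
    apply Rnot_lt_le. intros Lt.
    assert (exp (- (ln a * M)) < exp (- r * ln a)) by (apply exp_increasing; nra).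
    nra.
Qed.

(** * The embedding *)

Lemma sum_nonneg (D : nat -> R) m : (forall j, 0 <= D j) -> 0 <= sum_f_R0 D m.
Proof. intros H. apply cond_pos_sum; auto. Qed.

Lemma term_le_sum (D : nat -> R) m j :
  (forall j, 0 <= D j) -> (j <= m)%nat -> D j <= sum_f_R0 D m.
Proof.
  intros H. induction m; intros Hj; simpl.
  - replace j with 0%nat by lia. lra.
  - destruct (Nat.eq_dec j (S m)) as [->|].
    + pose proof (sum_nonneg D m H). lra.
    + pose proof (IHm ltac:(lia)). pose proof (H (S m)). lra.
Qed.

Lemma sum_squares_le_square_sum (D : nat -> R) m :
  (forall j, 0 <= D j) -> sum_f_R0 (fun j => D j ^ 2) m <= sum_f_R0 D m ^ 2.
Proof.
  intros H. induction m; simpl; [lra|].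
  pose proof (sum_nonneg D m H). pose proof (H (S m)). simpl in *. nra.
Qed.

(** Replaces the product distance by the sum over colors, which suits counting; [D] is indexed by
    all naturals to avoid bound proofs. *)
Lemma prod_dist_sum (m : nat) (T : Idx (S m) -> Type) (dT : forall i, T i -> T i -> R)
  (x y : prod_space (S m) T) (D : nat -> R) :
  (forall i, dT i (x i) (y i) = D (proj1_sig i)) -> (forall j, 0 <= D j) ->
  prod_dist (S m) T dT x y <= sum_f_R0 D m /\
  sum_f_R0 D m <= INR (S m) * prod_dist (S m) T dT x y.
Proof.
  intros HD Hpos.
  assert (E : prod_dist (S m) T dT x y = sqrt (sum_f_R0 (fun j => D j ^ 2) m)).
  { unfold prod_dist. f_equal. apply sum_eq. intros j Hj.
    destruct Compare_dec.lt_dec as [h|]; [|lia]. rewrite HD. auto. }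
  assert (Hsq : forall j, 0 <= D j ^ 2) by (intros; apply pow2_ge_0).
  rewrite E. split.
  - rewrite <- (sqrt_pow2 (sum_f_R0 D m)) by (apply sum_nonneg; auto).
    apply sqrt_le_1_alt, sum_squares_le_square_sum; auto.
  - set (Q := sqrt _).
    rewrite Rmult_comm, <- (sum_cte Q m). apply sum_Rle. intros j Hj.
    rewrite <- (sqrt_pow2 (D j)) by auto.
    apply sqrt_le_1_alt. apply (term_le_sum (fun j => D j ^ 2)); auto.
Qed.

(** Turns multiplicative constants on the boundary into additive shifts of height. The witness works
    because exp w > w for w = u/v. *)
Lemma exp_scale_lt (alpha u v : R) : 0 < alpha -> 0 < u -> 0 < v ->
  exists B, 0 <= B /\ u * exp (- (alpha * B)) < v.
Proof.
  intros Ha Hu Hv. exists (u / v / alpha). 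
  assert (Hw : 0 < u / v) by (apply Rdiv_lt_0_compat; auto).
  split; [left; apply Rdiv_lt_0_compat; auto|].
  replace (alpha * (u / v / alpha)) with (u / v) by (field; lra).
  rewrite exp_Ropp. pose proof (exp_ineq1 (u / v) ltac:(lra)) as He.
  apply Rmult_lt_reg_r with (exp (u / v)); [apply exp_pos|].
  rewrite Rmult_assoc, Rinv_l by (pose proof (exp_pos (u/v)); lra).
  replace (u * 1) with (v * (u / v)) by (field; lra).
  apply Rmult_lt_compat_l; lra.
Qed.

Lemma exp_pow u j : exp u ^ j = exp (u * INR j).
Proof.
  induction j; [simpl; rewrite Rmult_0_r, exp_0; auto|].
  rewrite S_INR. simpl. rewrite IHj, <- exp_plus. f_equal. ring.
Qed.

Section Embedding.
Context {X Z : Type} (d : X -> X -> R) (dZ : Z -> Z -> R) (m : nat)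
  (p : X) (zeta : X -> Z) (alpha C c1 c2 : R)
  (metX : is_metric d)
  (alpha_pos : 0 < alpha) (C_nonneg : 0 <= C) (c1_pos : 0 < c1) (c2_pos : 0 < c2)
  (dZ_upper : forall x x',
     dZ (zeta x) (zeta x') <= c2 * exp (- (alpha * (gp d p x x' - C))))
  (dZ_lower : forall x x' M, dZ (zeta x) (zeta x') < c1 * exp (- (alpha * M)) ->
     Rmin (Rmin (d x p) (d x' p)) M - C <= gp d p x x')
  (L tau0 c : R) (L_pos : 0 < L) (tau0_pos : 0 < tau0) (c_pos : 0 < c)
  (E : nat -> nat -> Z -> Z -> Prop)
  (E_sym : forall a j z w, E a j z w -> E a j w z)
  (E_trans : forall a j z w v, E a j z w -> E a j w v -> E a j z v)
  (E_diam : forall a j z w, E a j z w -> dZ z w <= tau0 * exp (- (alpha * L)) ^ j)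
  (E_nested : forall a i j z w, (i < j)%nat -> E a i z z -> E a j z w -> E a i z w)
  (E_margin : forall a i j z w, (i < j)%nat -> E a i z z -> E a j z z ->
     dZ z w < c * (tau0 * exp (- (alpha * L)) ^ j) -> E a i z w)
  (E_cover : forall j z, exists a, (a <= m)%nat /\ E a j z z)
  (level : X -> nat)
  (level_spec : forall x, INR (level x) * L <= d x p < (INR (level x) + 1) * L).

(** With ratio [exp (- (alpha * L))], level [j] corresponds to height [j * L]; the bounds by [level]
    cut each branch off at the height of its point. *)
Definition same_vertex (a j : nat) (x x' : X) : Prop :=
  (j < level x)%nat /\ (j < level x')%nat /\ E a j (zeta x) (zeta x').

Definition separating (a : nat) (x x' : X) : R :=
  count_below (fun j => same_vertex a j x x /\ ~ same_vertex a j x x') (level x).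

(** At levels up to [y] the scale dominates the boundary distance, so if two of them separated, the
    margin at the finer one would make the coarser hull common. Above [y] all levels are counted. *)
Lemma separating_upper : exists K, 0 <= K /\ forall a x x',
  separating a x x' <= 1 + (INR (level x) - (gp d p x x' - K) / L).
Proof.
  destruct (exp_scale_lt alpha c2 (c * tau0)) as (B & HB & HBlt); auto.
  { apply Rmult_lt_0_compat; auto. }
  (* [C] and [B] make the boundary distance smaller than the margin; [L] absorbs the rounding in
     [level x'], so that such levels lie on both branches. *)
  exists (C + B + L). split; [lra|]. intros a x x'.
  set (g := gp d p x x'). set (y := (g - (C + B + L)) / L).
  assert (Hy : y * L = g - (C + B + L)) by (unfold y; field; lra).
  pose proof (gp_le_dist d metX p x x') as G1.
  pose proof (gp_le_dist d metX p x' x) as G2. rewrite (gp_sym d metX p x' x) in G2.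
  fold g in G1, G2.
  pose proof (level_spec x) as Lx. pose proof (level_spec x') as Lx'.
  assert (near : forall j, INR j <= y ->
            (j < level x')%nat /\
            dZ (zeta x) (zeta x') < c * (tau0 * exp (- (alpha * L)) ^ j)).
  { intros j Hj. assert (HjL : INR j * L <= g - (C + B + L)) by nra. split.
    - apply INR_lt. nra.
    - eapply Rle_lt_trans; [apply dZ_upper|]. fold g. rewrite exp_pow.
      apply Rle_lt_trans with (c2 * (exp (- (alpha * B)) * exp (- (alpha * L) * INR j))).
      + apply Rmult_le_compat_l; [lra|]. rewrite <- exp_plus. apply exp_monotone. nra.
      + rewrite <- !Rmult_assoc. apply Rmult_lt_compat_r; [apply exp_pos|auto]. }
  unfold separating.
  set (P := fun j => same_vertex a j x x /\ ~ same_vertex a j x x').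
  assert (S1 : count_below P (level x) <=
     count_below (fun j => P j /\ INR j <= y) (level x) +
     count_below (fun j => y < INR j) (level x)).
  { apply count_below_or. intros j _ Hj. destruct (Rle_lt_dec (INR j) y); auto. }
  assert (S2 : count_below (fun j => P j /\ INR j <= y) (level x) <= 1).
  { apply count_below_le_one.
    intros i j Hij Hj (((_ & _ & Ei) & Ni) & _) (((_ & _ & Ej) & _) & Hjy).
    destruct (near j Hjy) as (Hj' & Hd). apply Ni. split; [lia|]. split; [lia|].
    apply E_margin with j; auto. }
  assert (S3 : count_below (fun j => y < INR j) (level x) <= INR (level x) - y).
  { apply count_below_gt_upper. nra. }
  lra.
Qed.

(** Beyond height (x|x') + K the scale is too small for a hull to contain both boundary points, so
    the color whose hull covers [zeta x] separates. *)
Lemma separating_lower : exists K, 0 <= K /\ forall x x',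
  INR (level x) - (gp d p x x' + K) / L - 1 <= sum_f_R0 (fun a => separating a x x') m.
Proof.
  destruct (exp_scale_lt alpha tau0 c1) as (B & HB & HBlt); auto.
  exists (C + B). split; [lra|]. intros x x'.
  set (g := gp d p x x'). set (y := (g + (C + B)) / L).
  assert (Hy : y * L = g + (C + B)) by (unfold y; field; lra).
  pose proof (gp_nonneg d metX p x x') as G. fold g in G.
  assert (Hy0 : 0 <= y) by (apply Rmult_le_reg_r with L; lra).
  eapply Rle_trans; [apply (count_below_gt_lower y (level x)); auto|].
  apply count_below_union. intros j Hj Hyj.
  destruct (E_cover j (zeta x)) as (a & Ha & Ea). exists a. split; auto.
  split; [split; auto|]. intros (_ & Hj' & Exx'). apply E_diam in Exx'.
  rewrite exp_pow in Exx'.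
  assert (HjL : g + (C + B) < INR j * L) by nra.
  pose proof (level_spec x). pose proof (level_spec x').
  assert (INR j <= INR (level x)) by (apply le_INR; lia).
  assert (INR j <= INR (level x')) by (apply le_INR; lia).
  assert (INR j * L <= INR (level x) * L) by nra.
  assert (INR j * L <= INR (level x') * L) by nra.
  (* Taking [M] as [INR j * L - B] absorbs the ratio of [tau0] to [c1]; both heights are at least
     [INR j * L], which contradicts [HjL]. *)
  assert (Hlow : Rmin (Rmin (d x p) (d x' p)) (INR j * L - B) - C <= gp d p x x').
  { apply dZ_lower. eapply Rle_lt_trans; [exact Exx'|].
    replace (- (alpha * L) * INR j)
      with (- (alpha * B) + - (alpha * (INR j * L - B))) by ring.
    rewrite exp_plus, <- Rmult_assoc. apply Rmult_lt_compat_r; [apply exp_pos|auto]. }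
  fold g in Hlow. split_min; lra.
Qed.

Lemma embedding_of_nested_relations :
  exists (T : Idx (S m) -> Type) (dT : forall i, T i -> T i -> R),
    (forall i, metric_tree (dT i)) /\
    exists f : X -> prod_space (S m) T, qi_embedding d (prod_dist (S m) T dT) f.
Proof.
  assert (tree : forall a,
    {T : Type & {dT : T -> T -> R & {f : X -> T | metric_tree dT /\
      forall x x', dT (f x) (f x') = separating a x x' + separating a x' x}}}).
  { intros a. apply (tree_of_nested_relations level (same_vertex a) p).
    - intros j x x' H. apply H.
    - intros j x x' (H1 & H2 & H3). repeat split; auto.
    - intros j x y z (H1 & H2 & H3) (H4 & H5 & H6). repeat split; eauto.
    - intros i j x x' Hij (H1 & _ & H3) (H4 & H5 & H6).
      split; [auto|]. split; [lia|]. apply E_nested with j; auto. }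
  exists (fun i => projT1 (tree (proj1_sig i))).
  exists (fun i => projT1 (projT2 (tree (proj1_sig i)))).
  pose (f := fun a => proj1_sig (projT2 (projT2 (tree a)))).
  assert (Hf : forall a, metric_tree (projT1 (projT2 (tree a))) /\
     forall x x', projT1 (projT2 (tree a)) (f a x) (f a x')
                  = separating a x x' + separating a x' x).
  { intros a. exact (proj2_sig (projT2 (projT2 (tree a)))). }
  split; [intros i; apply Hf|].
  exists (fun x i => f (proj1_sig i) x).
  destruct separating_upper as (K1 & HK1 & Hup).
  destruct separating_lower as (K2 & HK2 & Hlow).
  assert (HL : 0 < / L) by (apply Rinv_0_lt_compat; auto).
  pose (n := INR (S m)).
  assert (Hn : 0 < n) by (apply lt_0_INR; lia).
  assert (HnL : 0 < n * L /\ 0 < n * / L) by (split; apply Rmult_lt_0_compat; auto).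
  (* The first summand serves the upper bound, over [n] colors; the second serves the lower one,
     where 4 collects two roundings of levels and two losses in counting. *)
  set (sig := n * (2 + 2 * K1 / L) + (4 + 2 * K2 / L) / n).
  exists (1 + n * L + n * / L), sig.
  assert (HK1L : 0 <= 2 * K1 / L) by (apply Rmult_le_pos; lra).
  assert (HK2L : 0 <= 2 * K2 / L) by (apply Rmult_le_pos; lra).
  assert (Hs1 : 0 <= n * (2 + 2 * K1 / L)) by (apply Rmult_le_pos; lra).
  assert (Hs2 : 0 <= (4 + 2 * K2 / L) / n).
  { apply Rmult_le_pos; [lra|]. left. apply Rinv_0_lt_compat; auto. }
  split; [lra|]. split; [unfold sig; lra|]. intros x x'.
  destruct (prod_dist_sum m (fun i => projT1 (tree (proj1_sig i)))
     (fun i => projT1 (projT2 (tree (proj1_sig i))))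
     (fun i => f (proj1_sig i) x) (fun i => f (proj1_sig i) x')
     (fun a => separating a x x' + separating a x' x)) as (P1 & P2).
  { intros i. apply Hf. }
  { intros a. apply Rplus_le_le_0_compat; apply count_below_pos. }
  set (Q := prod_dist _ _ _ _ _) in *. fold n in P2.
  assert (HD : 0 <= d x x') by apply metX.
  assert (Eg : d x p + d x' p - 2 * gp d p x x' = d x x') by (unfold gp; lra).
  pose proof (level_spec x) as Lx. pose proof (level_spec x') as Lx'.
  assert (I : forall x, INR (level x) <= d x p * / L < INR (level x) + 1).
  { intros y. destruct (level_spec y). split.
    - apply Rmult_le_reg_r with L; auto. rewrite Rmult_assoc, Rinv_l; lra.
    - apply Rmult_lt_reg_r with L; auto. rewrite Rmult_assoc, Rinv_l; lra. }
  pose proof (I x) as Ix. pose proof (I x') as Ix'.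
  assert (EgL : d x p * / L + d x' p * / L - 2 * (gp d p x x' * / L) = d x x' * / L)
    by (rewrite <- Eg; ring).
  split.
  - assert (A1 : / (1 + n * L + n * / L) * d x x' <= d x x' * / L * / n).
    { rewrite Rmult_assoc, <- Rinv_mult, Rmult_comm. apply Rmult_le_compat_l; auto.
      apply Rinv_le_contravar; lra. }
    assert (A2 : d x x' * / L - (4 + 2 * K2 / L) <= n * Q).
    { eapply Rle_trans; [|exact P2]. rewrite plus_sum.
      pose proof (Hlow x x') as H1. pose proof (Hlow x' x) as H2.
      rewrite (gp_sym d metX p x' x) in H2.
      unfold Rdiv in *. rewrite Rmult_plus_distr_r in H1, H2. lra. }
    assert (A3 : d x x' * / L * / n - (4 + 2 * K2 / L) / n <= Q).
    { apply Rmult_le_reg_l with n; auto. unfold Rdiv.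
      replace (n * (d x x' * / L * / n - (4 + 2 * K2 * / L) * / n))
        with (d x x' * / L - (4 + 2 * K2 * / L)) by (field; lra). exact A2. }
    unfold sig. lra.
  - eapply Rle_trans; [exact P1|].
    apply Rle_trans with (n * (2 + 2 * K1 / L + d x x' * / L)).
    + unfold n. rewrite Rmult_comm, <- sum_cte. apply sum_Rle. intros a _.
      pose proof (Hup a x x') as H1. pose proof (Hup a x' x) as H2.
      rewrite (gp_sym d metX p x' x) in H2.
      unfold Rdiv in *. rewrite Rmult_minus_distr_r in H1, H2. lra.
    + unfold sig.
      assert (0 <= (1 + n * L) * d x x') by (apply Rmult_le_pos; lra). nra.
Qed.
End Embedding.

Theorem theorem1p1 (X : Type) (d : X -> X -> R) (o : X)
  (dZ : Boundary d o -> Boundary d o -> R) (m : nat) :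
  is_metric d -> gromov_hyperbolic d -> visual_space d ->
  visual_metric d o dZ -> is_cdim dZ m ->
  exists (T : Idx (S m) -> Type) (dT : forall i, T i -> T i -> R),
    (forall i, metric_tree (dT i)) /\
    exists f : X -> prod_space (S m) T,
      qi_embedding d (prod_dist (S m) T dT) f.
Proof.
  intros Hm Hh Hv HvZ (Hcdim & _).
  destruct (visual_boundary_model d o dZ Hm Hh Hv HvZ)
    as (p & zeta & alpha & C & c1 & c2 & Ha & HC & Hc1 & Hc2 & Hz).
  destruct (cdim_le_nested_relations dZ m (proj1 HvZ) Hcdim)
    as (tau0 & r0 & c & Htau0 & Hr0 & Hc & HE).
  destruct (exp_scale_lt alpha 1 r0) as (L0 & HL0 & HL0r); auto; [lra|].
  (* Adding 1 ensures [0 < L], as [L0] may be 0, and only decreases the ratio. *)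
  set (L := L0 + 1). assert (HL : 0 < L) by (unfold L; lra).
  assert (Hr : exp (- (alpha * L)) <= r0).
  { assert (exp (- (alpha * L)) <= exp (- (alpha * L0))); [|lra].
    apply exp_monotone. unfold L. nra. }
  destruct (HE (exp (- (alpha * L))) (exp_pos _) Hr)
    as (E & Esym & Etrans & Ediam & Enest & Emargin & Ecover).
  assert (Hlev : forall x, exists n, INR n * L <= d x p < (INR n + 1) * L).
  { intros x. destruct (nfloor_ex (d x p / L)) as (n & Hn).
    - apply Rmult_le_pos; [apply Hm|]. left. apply Rinv_0_lt_compat; auto.
    - exists n. replace (d x p) with (d x p / L * L) by (field; lra).
      split; [apply Rmult_le_compat_r|apply Rmult_lt_compat_r]; lra. }
  pose (level := fun x => proj1_sig (constructive_indefinite_description _ (Hlev x))).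
  apply (embedding_of_nested_relations d dZ m p zeta alpha C c1 c2 Hm Ha HC Hc1 Hc2
    (fun x x' => proj1 (Hz x x')) (fun x x' => proj2 (Hz x x')) L tau0 c HL Htau0 Hc
    E Esym Etrans Ediam Enest Emargin Ecover level).
  intros x. exact (proj2_sig (constructive_indefinite_description _ (Hlev x))).
Qed.
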